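(* Let $H$ be a complex Hilbert space with $\dim H\geq 3$ and let $T\in B(H)$ be such that $T^3=0$. If $\operatorname{Re}(T^2)\geq 0$ or $\operatorname{Im}(T^2)\geq 0$, then $T$ is complex symmetric.
   Context: $H$ is a complex Hilbert space (possibly infinite-dimensional) and $B(H)$ is the algebra of bounded linear operators from $H$ into itself. For $S\in B(H)$, $\operatorname{Re} S=(S+S^* )/2$ and $\operatorname{Im} S=(S-S^* )/(2\mathrm{i})$ (both self-adjoint operators), where $S^*$ is the adjoint of $S$; $S\geq 0$ (positive) means $\langle Sx,x\rangle\geq 0$ for all $x\in H$. A conjugation on $H$ is a conjugate-linear map $C:H\to H$ that is both involutive ($C^2=I$) and isometric. An operator $T\in B(H)$ is complex symmetric if $T=CT^*C$ for some conjugation $C$ on $H$. *)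

(* Defs.v *)
From HB Require Import structures.
From mathcomp Require Import all_boot all_order all_algebra sesquilinear.
From mathcomp Require Import complex.
From mathcomp Require Import all_classical all_reals.
From mathcomp Require Import topology normedtype.

Set Implicit Arguments.
Unset Strict Implicit.
Unset Printing Implicit Defensive.

Import Order.TTheory GRing.Theory Num.Theory.
Import numFieldNormedType.Exports.

Local Open Scope classical_set_scope.
Local Open Scope ring_scope.

(* The scalar product is linear in its first argument and conjugate-linear in
   its second one. *)
HB.mixin Record isHilbert (R : realType) H & CompleteNormedModule R[i] H := {
  hdot : {dot H for (@Num.conj R[i])} ;
  hdot_norm : forall x : H, hdot x x = `|x| ^+ 2
}.

#[short(type="hilbertType")]
HB.structure Definition Hilbert (R : realType) :=
  {H of isHilbert R H & CompleteNormedModule R[i] H}.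

Section Operators.
Context {R : realType} {H : hilbertType R}.
Implicit Types S C : H -> H.

Local Notation "''[' x , y ]" := (hdot x y) : ring_scope.

(* [adjoint S y] is the vector z such that <S x, y> = <x, z> for all x; it is
   unique, and exists by Riesz representation when S is linear and bounded. *)
Definition adjoint S : H -> H :=
  fun y => xget 0 [set z | forall x, '[S x, y] = '[x, z]].

Definition re_op S : H -> H := fun x => 2^-1 *: (S x + adjoint S x).

Definition im_op S : H -> H := fun x => (2 * 'i)^-1 *: (S x - adjoint S x).

(* The order of R[i] makes [0 <= z] mean that z is real and nonnegative. *)
Definition positive_op S := forall x, 0 <= '[S x, x].

Definition conjugation C :=
  [/\ linear_for (@Num.conj R[i] \; *:%R) C, involutive C
    & forall x, `|C x| = `|x|].

Definition complex_symmetric S :=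
  exists2 C, conjugation C & S = C \o adjoint S \o C.

End Operators.

(* dim V >= n, for V of possibly infinite dimension: V contains n linearly
   independent vectors. *)
Definition dim_geq (K : fieldType) (V : lmodType K) (n : nat) :=
  exists v : 'I_n -> V,
    forall a : 'I_n -> K, \sum_(i < n) a i *: v i = 0 -> forall i, a i = 0.

(* Main.v *)
Require Import Defs.
From mathcomp Require Import all_boot all_order all_algebra complex.
From mathcomp Require Import all_classical all_reals topology normedtype.
From mathcomp Require Import sesquilinear ring lra.
Import GRing.Theory Num.Theory numFieldNormedType.Exports.
Import Order.TTheory.
Local Open Scope classical_set_scope.
Local Open Scope ring_scope.

(** Write N = T^2, so that N^2 = T^4 = 0. On the line x - t N x (t real) the
    quadratic form Re <N u, u> equals Re <N x, x> - t |N x|^2; being bounded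
    below by 0 for every t, it forces N x = 0. The imaginary part is handled by
    the same remark for -i N. Hence T^2 = 0 ([accretive_square_zero],
    [re_im_positive_eq0]), and what remains is that every bounded operator of
    square zero is complex symmetric.

    A conjugation C with T = C T* C is obtained as C = W J, where J is a
    conjugation commuting with T and T*, and W is a self-adjoint unitary
    involution that commutes with J and satisfies W T = T* W.

    - Existence of J ([maximal_conjugation]). Zorn's lemma gives a maximal set
      S, stable under T and T*, on which the scalar product takes real values.
      If x is orthogonal to S and T* x = 0, then the vectors (T* T)^n x and
      T (T* T)^n x could be added to S, because <(T* T)^n x, x> is real and the
      two families are orthogonal to each other; so maximality makes S total.
      Maximality also makes S equal to its real bidual, hence a closed real
      subspace, and orthogonal projection onto S shows that H = S + i S. Then J
      is a + i b |-> a - i b.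

    - Existence of W ([intertwining_symmetry]). Let B = T + T*, a self-adjoint
      operator with B^2 = T T* + T* T, which commutes with T and T*. Although B
      itself does not commute with T, B^2 has a self-adjoint square root Q that
      commutes with everything that commutes with B^2
      ([square_root_of_square]). W is the reflection in ker (B - Q), that is,
      a sign of B: Q W = B = W Q. Therefore W T Q = B T = T* T and
      T* W Q = T* B = T* T, so that W T and T* W agree on the range of Q, and
      they agree on ker Q = ker B = ker T /\ ker T*, where W is the identity.

    The Hilbert space theory behind these steps (projections, the Riesz
    representation, the square root) is developed for the real scalar product
    Re <x, y>. Linear and conjugate-linear operators can then be treated alike,
    and the estimates take place in an ordered field. *)

(** * The real scalar product *)

Section RealInnerProduct.
Context {R : realType} {H : hilbertType R}.
Implicit Types (x y z : H) (r : R).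

Definition rdot x y : R := complex.Re (hdot x y).
Definition nrm x : R := complex.Re `|x|.
Definition rscale r x : H := (r%:C)%C *: x.

Lemma hdotC x y : hdot x y = Num.conj (hdot y x).
Proof. by rewrite hermC expr0 mul1r. Qed.

Lemma conjE (c : R[i]) : Num.conj c = (c^*)%C.
Proof. by []. Qed.

Lemma rdotC x y : rdot x y = rdot y x.
Proof. by rewrite /rdot hdotC conjE; case: (hdot y x). Qed.

Lemma ReD (a b : R[i]) : complex.Re (a + b) = complex.Re a + complex.Re b.
Proof. by case: a b => [? ?] []. Qed.

Lemma ReN (a : R[i]) : complex.Re (- a) = - complex.Re a.
Proof. by case: a. Qed.

Lemma ReM r (a : R[i]) : complex.Re ((r%:C)%C * a) = r * complex.Re a.
Proof. by case: a => a b /=; rewrite mul0r subr0. Qed.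

Lemma rdotDl x y z : rdot (x + y) z = rdot x z + rdot y z.
Proof. by rewrite /rdot linearDl ReD. Qed.

Lemma rdotNl x z : rdot (- x) z = - rdot x z.
Proof. by rewrite /rdot linearNl ReN. Qed.

Lemma rdotZl r x z : rdot (rscale r x) z = r * rdot x z.
Proof. by rewrite /rdot /rscale linearZl ReM. Qed.

Lemma hdotI x y : hdot ('i *: x) ('i *: y) = hdot x y.
Proof.
rewrite linearZl /= linearZr /= mulrA.
by rewrite -normCK normCi expr1n mul1r.
Qed.

Lemma rdotI x y : rdot ('i *: x) ('i *: y) = rdot x y.
Proof. by rewrite /rdot hdotI. Qed.

(** The complex scalar product is recovered from the real one, so complex-linear
    and conjugate-linear statements reduce to real ones and to multiplication
    by i. *)
Lemma hdotE x y : hdot x y = ((rdot x y) +i* (rdot x ('i *: y)))%C.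
Proof.
rewrite /rdot linearZr /= -complexiE; case: (hdot x y) => a b /=.
by congr Complex; ring.
Qed.

Lemma nrm_sqr x : rdot x x = nrm x ^+ 2.
Proof.
rewrite /rdot hdot_norm /nrm; have : 0 <= `|x| by [].
case: (`|x|) => a b; rewrite lecE /= => /andP[/eqP-> _].
by rewrite expr2 /= mul0r subr0 -expr2.
Qed.

Lemma nrm_norm x : `|x| = ((nrm x)%:C)%C.
Proof. by rewrite /nrm RRe_real // ger0_real. Qed.

Lemma nrm_ge0 x : 0 <= nrm x.
Proof. by rewrite -ler0c -nrm_norm. Qed.

Lemma nrm_eq0 x : nrm x = 0 -> x = 0.
Proof. by move=> x0; apply/eqP; rewrite -normr_eq0 nrm_norm x0. Qed.

Lemma nrmD x y : nrm (x + y) <= nrm x + nrm y.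
Proof. by rewrite -lecR rmorphD /= -!nrm_norm ler_normD. Qed.

Lemma nrmN x : nrm (- x) = nrm x.
Proof. by rewrite /nrm normrN. Qed.

Lemma nrmB x y : nrm (x - y) = nrm (y - x).
Proof. by rewrite -nrmN opprB. Qed.

Lemma nrmZ r x : nrm (rscale r x) = `|r| * nrm x.
Proof.
apply: complexI; rewrite rmorphM /= -!nrm_norm normrZ normc_def /=.
by rewrite expr0n addr0 sqrtr_sqr.
Qed.

Lemma nrmI x : nrm ('i *: x) = nrm x.
Proof. by rewrite /nrm normrZ normCi mul1r. Qed.

Lemma rdotDr x y z : rdot z (x + y) = rdot z x + rdot z y.
Proof. by rewrite ![rdot z _]rdotC rdotDl. Qed.

Lemma rdotNr x z : rdot z (- x) = - rdot z x.
Proof. by rewrite ![rdot z _]rdotC rdotNl. Qed.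

Lemma rdotZr r x z : rdot z (rscale r x) = r * rdot z x.
Proof. by rewrite ![rdot z _]rdotC rdotZl. Qed.

Definition rdotE :=
  (rdotDl, rdotDr, rdotNl, rdotNr, rdotZl, rdotZr).

Lemma rdotIl x y : rdot ('i *: x) y = - rdot x ('i *: y).
Proof.
by rewrite -[in RHS]rdotI scalerA -expr2 sqrCi scaleN1r rdotNr opprK.
Qed.

Lemma rdot_eq0 x : rdot x x = 0 -> x = 0.
Proof. by rewrite nrm_sqr => /eqP; rewrite sqrf_eq0 => /eqP/nrm_eq0. Qed.

Lemma rdot_inj x y : (forall z, rdot z x = rdot z y) -> x = y.
Proof.
move=> xy; apply/eqP; rewrite -subr_eq0; apply/eqP/rdot_eq0.
by rewrite rdotDr rdotNr xy subrr.
Qed.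

Lemma rscaleI r x : 'i *: rscale r x = rscale r ('i *: x).
Proof. by rewrite /rscale !scalerA mulrC. Qed.

Lemma rscaleDr r x y : rscale r (x + y) = rscale r x + rscale r y.
Proof. exact: scalerDr. Qed.

Lemma rscaleBr r x y : rscale r (x - y) = rscale r x - rscale r y.
Proof. exact: scalerBr. Qed.

Lemma rscaleA (a b : R) x : rscale a (rscale b x) = rscale (a * b) x.
Proof. by rewrite /rscale scalerA -rmorphM. Qed.

Lemma rscale1 x : rscale 1 x = x.
Proof. exact: scale1r. Qed.

Lemma rscaleDl (a b : R) x : rscale (a + b) x = rscale a x + rscale b x.
Proof. by rewrite /rscale rmorphD scalerDl. Qed.

Lemma rscaleN1 x : rscale (-1) x = - x.
Proof. by rewrite /rscale rmorphN scaleN1r. Qed.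

Lemma rscale0 x : rscale 0 x = 0.
Proof. exact: scale0r. Qed.

Lemma scale_rscale (a : R[i]) x :
  a *: x = rscale (complex.Re a) x + rscale (complex.Im a) ('i *: x).
Proof.
by rewrite /rscale scalerA -scalerDl [X in _ + X]mulrC -complexiE -complexE.
Qed.

Lemma cauchy_schwarz x y : rdot x y <= nrm x * nrm y.
Proof.
have [x0|x0] := eqVneq (nrm x) 0.
  by rewrite x0 mul0r -[x]add0r (nrm_eq0 x x0) addr0 -(rscale0 0) rdotZl mul0r.
have [y0|y0] := eqVneq (nrm y) 0.
  by rewrite y0 mulr0 rdotC (nrm_eq0 y y0) -(rscale0 0) rdotZl mul0r.
have xy_gt0 : 0 < nrm x * nrm y by rewrite mulr_gt0 // lt_def ?x0 ?y0 nrm_ge0.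
have := nrm_ge0 (rscale (nrm y) x - rscale (nrm x) y).
move=> /(exprn_ge0 2); rewrite -nrm_sqr !rdotE !nrm_sqr (rdotC y x) => h.
rewrite -subr_ge0 -(pmulr_rge0 _ xy_gt0); nra.
Qed.

Lemma cauchy_schwarz_abs x y : `|rdot x y| <= nrm x * nrm y.
Proof.
rewrite ler_norml lerNl -rdotNl cauchy_schwarz andbT.
by rewrite -[nrm x]nrmN cauchy_schwarz.
Qed.

(** Completeness with an explicit modulus: the bound on the tails passes to the
    limit, which dispenses with convergence arguments later on. *)
Lemma hilbert_complete (u : nat -> H) (e : nat -> R) :
  (forall n m, (n <= m)%N -> nrm (u m - u n) <= e n) ->
  (forall eps, 0 < eps -> exists n, e n < eps) ->
  exists l, forall n, nrm (l - u n) <= e n.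
Proof.
move=> ue e0.
have eR (eps : R[i]) :
    0 < eps -> 0 < complex.Re eps /\ eps = ((complex.Re eps)%:C)%C.
  by case: eps => a b; rewrite ltcE /= => /andP[/eqP->].
have cu : cvg (u @ \oo).
  apply/cauchy_cvgP/cauchy_exP => eps /eR[ep ->].
  have [n en] := e0 _ ep; exists (u n); exists n => // m /= nm.
  rewrite -ball_normE /= nrm_norm ltcR nrmB.
  exact: le_lt_trans (ue _ _ nm) en.
exists (lim (u @ \oo)) => n; apply/ler_addgt0Pr => eps ep.
have /cvgrPdist_lt/(_ (eps%:C)%C) := cu; rewrite ltcR => /(_ ep)[N _ uN].
have := uN (maxn N n) (leq_maxl _ _); rewrite nrm_norm ltcR => /ltW h.
rewrite -(subrK (u (maxn N n)) (lim _)) -addrA addrC.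
rewrite (le_trans (nrmD _ _))// lerD// ?ue ?leq_maxr//.
Qed.

End RealInnerProduct.

(** * Projections and adjoints *)

Section Projection.
Context {R : realType} {H : hilbertType R}.
Implicit Types (x y z : H) (r : R) (K : set H).

Lemma exists_div_lt (c eps : R) : 0 <= c -> 0 < eps ->
  exists n : nat, c / n.+1%:R < eps.
Proof.
move=> c0 e0; exists (Num.bound (c / eps)).
have := archi_boundP (divr_ge0 c0 (ltW e0)).
rewrite ltr_pdivrMr // ltr_pdivrMr ?ltr0Sn // mulrC => /lt_le_trans; apply.
by rewrite ler_wpM2l ?ltW // ltr_nat.
Qed.

(** Real subspaces are needed, since the fixed points of a conjugation do not
    form a complex one. *)
Definition closed_real_subspace K :=
  [/\ K 0, forall x y, K x -> K y -> K (x + y),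
      forall r x, K x -> K (rscale r x) &
      forall x, (forall eps, 0 < eps -> exists2 s, K s & nrm (x - s) < eps) ->
        K x].

Lemma orthogonal_closed (I : Type) (D : set I) (f : I -> H) :
  closed_real_subspace [set v | forall i, D i -> rdot v (f i) = 0].
Proof.
split=> [i _|x y Vx Vy i Di|r x Vx i Di|x xcl i Di].
- by rewrite -(rscale0 0) rdotZl mul0r.
- by rewrite rdotDl Vx // Vy // addr0.
- by rewrite rdotZl Vx // mulr0.
- apply/eqP/negPn/negP; rewrite -normr_gt0 => xi.
  have f1 : 0 < nrm (f i) + 1 by rewrite ltr_wpDl // nrm_ge0.
  have [t Vt xt] := xcl _ (divr_gt0 xi f1).
  have := cauchy_schwarz_abs (x - t) (f i).
  rewrite rdotDl rdotNl Vt // subr0 => h.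
  move: xt; rewrite ltr_pdivlMr // ltNge => /negP; apply.
  by apply: le_trans h _; rewrite ler_wpM2l ?nrm_ge0 // lerDl.
Qed.

(** Moving a closest point a to a + t s, with t small of the sign of
    Re <y - a, s>, would bring it closer to y. *)
Lemma closest_point_orthogonal K y a : closed_real_subspace K -> K a ->
  (forall k, K k -> nrm (y - a) <= nrm (y - k)) ->
  forall s, K s -> rdot (y - a) s = 0.
Proof.
move=> [K0 KD KZ _] Ka amin s Ks; set c := rdot _ _.
(* The optimal t is c / |s|^2; adding 1 avoids the case s = 0. *)
pose t := c / (nrm s ^+ 2 + 1).
have d_gt0 : 0 < nrm s ^+ 2 + 1 by rewrite ltr_wpDl ?sqr_ge0.
have := amin _ (KD _ _ Ka (KZ t s Ks)).
move=> /(@lerXn2r _ 2 _ _ (nrm_ge0 _) (nrm_ge0 _)).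
have -> : y - (a + rscale t s) = (y - a) - rscale t s by rewrite opprD addrA.
rewrite -!nrm_sqr.
move: @c @t; generalize (y - a) => w c t.
rewrite !rdotE (rdotC s) -/c (nrm_sqr s).
have -> : c = t * (nrm s ^+ 2 + 1) by rewrite /t divfK // gt_eqF.
move: (nrm s ^+ 2) (sqr_ge0 (nrm s)) => N N0 h.
have : t ^+ 2 * (N + 2) <= 0 by nra.
rewrite pmulr_lle0; last by lra.
by rewrite le_eqVlt ltNge sqr_ge0 orbF sqrf_eq0 => /eqP->; rewrite mul0r.
Qed.

Lemma nrm_parallelogram x y :
  nrm (x - y) ^+ 2 = 2 * nrm x ^+ 2 + 2 * nrm y ^+ 2 - nrm (x + y) ^+ 2.
Proof. by rewrite -!nrm_sqr !rdotE (rdotC y); ring. Qed.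

(** By the parallelogram identity, a minimizing sequence is a Cauchy sequence:
    midpoints of its terms cannot be closer to y than the infimum. *)
Lemma closest_point K y : closed_real_subspace K ->
  exists2 a, K a & forall k, K k -> nrm (y - a) <= nrm (y - k).
Proof.
move=> [K0 KD KZ Kcl].
pose D := [set nrm (y - s) ^+ 2 | s in K].
have Dlb : lbound D 0 by move=> _ [s _ <-]; exact: sqr_ge0.
have Dinf : has_inf D by split; [exists (nrm (y - 0) ^+ 2), 0 | exists 0].
have infD s : K s -> inf D <= nrm (y - s) ^+ 2.
  by move=> Ks; apply: ge_inf; [exists 0 | exists s].
have /choice[a aP] (n : nat) :
    exists a, K a /\ nrm (y - a) ^+ 2 < inf D + (n.+1%:R ^- 2).
  have [|_ [s Ks <-] ?] := @inf_adherent _ D (n.+1%:R ^- 2) _ Dinf.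
    by rewrite invr_gt0 exprn_gt0.
  by exists s.
have inv_le n m : (n <= m)%N -> (m.+1%:R^-1 : R) <= n.+1%:R^-1.
  by move=> nm; rewrite lef_pV2 ?posrE// ler_nat.
have [||l al] := @hilbert_complete R H a (fun n => 2 / n.+1%:R).
- move=> n m nm; rewrite -(@ler_pXn2r _ 2) ?nnegrE ?nrm_ge0 ?divr_ge0//.
  have [Kn /ltW dn] := aP n; have [Km /ltW dm] := aP m.
  have -> : a m - a n = (y - a n) - (y - a m).
    by rewrite opprB [RHS]addrC addrA subrK.
  rewrite nrm_parallelogram.
  have -> : (y - a n) + (y - a m) = rscale 2 (y - rscale (2^-1) (a n + a m)).
    rewrite rscaleDr -[- rscale _ _]rscaleN1 !rscaleA.
    rewrite (_ : 2 * -1 / 2 = -1 :> R) ?rscaleN1; last by field.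
    by rewrite -[2]/(1 + 1) rscaleDl rscale1 opprD addrACA.
  have := infD _ (KZ 2^-1 _ (KD _ _ Kn Km)).
  rewrite -exprVn in dn; rewrite -exprVn in dm.
  rewrite nrmZ !exprMn real_normK ?num_real //.
  have : (m.+1%:R^-1 : R) ^+ 2 <= n.+1%:R^-1 ^+ 2.
    by rewrite lerXn2r ?nnegrE ?invr_ge0// inv_le.
  move: dn dm; move: (nrm (y - a n) ^+ 2) (nrm (y - a m) ^+ 2) => p q.
  move: (n.+1%:R^-1 ^+ 2) (m.+1%:R^-1 ^+ 2) (nrm _ ^+ 2) => en em d.
  by lra.
- by move=> eps; apply: exists_div_lt.
exists l => [|k Kk].
  apply: Kcl => eps /(@exists_div_lt 2 _ ltac:(by []))[n en].
  by exists (a n); [have [] := aP n | apply: le_lt_trans en].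
apply/ler_addgt0Pr => eps /(@exists_div_lt 3 _ ltac:(by []))[n en].
have [_ dn] := aP n.
have {}dn : nrm (y - a n) <= nrm (y - k) + n.+1%:R^-1.
  rewrite -(@ler_pXn2r _ 2) ?nnegrE ?addr_ge0 ?nrm_ge0 ?invr_ge0//.
  have := infD _ Kk; rewrite -exprVn in dn.
  have : 0 <= nrm (y - k) * n.+1%:R^-1 by rewrite mulr_ge0 ?invr_ge0 ?nrm_ge0.
  rewrite sqrrD; move: dn; move: (nrm (y - a n) ^+ 2) => p.
  move: (nrm (y - k) * _) (nrm (y - k) ^+ 2) (n.+1%:R^-1 ^+ 2) => q s t.
  by lra.
have -> : y - l = (y - a n) - (l - a n) by rewrite opprB addrA subrK.
have := nrmD (y - a n) (- (l - a n)); rewrite nrmN; have := al n.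
move: en dn; move: (n.+1%:R^-1) (nrm (y - a n)) (nrm (l - a n)) => e p q.
by move: (nrm _) (nrm _) => s t; lra.
Qed.

Lemma orthogonal_projection K y : closed_real_subspace K ->
  exists2 a, K a & forall s, K s -> rdot (y - a) s = 0.
Proof.
move=> cK; have [a Ka amin] := closest_point K y cK; exists a => //.
exact: closest_point_orthogonal.
Qed.

(** The vector representing f is proportional to the component orthogonal to
    ker f of any vector on which f does not vanish. *)
Lemma riesz (f : H -> R) (M : R) : {morph f : x y / x + y} ->
  (forall r x, f (rscale r x) = r * f x) ->
  (forall x, `|f x| <= M * nrm x) ->
  exists z, forall x, f x = rdot x z.
Proof.
move=> fD fZ fM.
have f0 : f 0 = 0 by apply: (addIr (f 0)); rewrite -fD !add0r.
have fN x : f (- x) = - f x by apply: (addIr (f x)); rewrite -fD !addNr.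
pose K := [set x | f x = 0].
have cK : closed_real_subspace K.
  split => //=; rewrite /K/=.
  - by move=> x y fx fy; rewrite fD fx fy addr0.
  - by move=> r x fx; rewrite fZ fx mulr0.
  - move=> x xcl; apply/eqP/negPn/negP; rewrite -normr_gt0 => fx.
    have M1 : 0 < `|M| + 1 by rewrite ltr_wpDl.
    have [s fs xs] := xcl _ (divr_gt0 fx M1).
    have := fM (x - s); rewrite fD fN fs subr0 => fxs.
    move: xs; rewrite ltr_pdivlMr// ltNge => /negP; apply.
    rewrite (le_trans fxs)// mulrC ler_wpM2l ?nrm_ge0//.
    by rewrite (le_trans (ler_norm _))// lerDl.
have [f_eq0|/existsNP[y fy]] := pselect (forall x, f x = 0).
  by exists 0 => x; rewrite f_eq0 -(subrr x) rdotDr rdotNr subrr.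
have [a fa ya] := orthogonal_projection K y cK.
set b := y - a in ya; have fb : f b = f y by rewrite fD fN fa subr0.
have b0 : nrm b ^+ 2 != 0.
  apply/eqP => /eqP; rewrite sqrf_eq0 => /eqP/nrm_eq0 b0.
  by move: fb; rewrite b0 f0 => /esym.
exists (rscale (f b / nrm b ^+ 2) b) => x.
have : K (rscale (f b) x - rscale (f x) b).
  by rewrite /K /= fD fN !fZ mulrC subrr.
move=> /ya; rewrite rdotDr rdotNr !rdotZr nrm_sqr (rdotC b) => /subr0_eq.
by rewrite mulrAC => ->; rewrite mulfK.
Qed.

Lemma adjoint_exists (T : {linear H -> H}) (M : R) :
  (forall x, nrm (T x) <= M * nrm x) ->
  exists Ts : H -> H, forall x y, rdot (T x) y = rdot x (Ts y).
Proof.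
move=> TM.
suff /choice[Ts TsP] (y : H) : exists z, forall x, rdot (T x) y = rdot x z.
  by exists Ts.
apply: (@riesz _ (M * nrm y)) => [x z|r x|x].
- by rewrite linearD rdotDl.
- by rewrite /rscale linearZ rdotZl.
- by rewrite (le_trans (cauchy_schwarz_abs _ _))// mulrAC ler_wpM2r ?nrm_ge0.
Qed.

End Projection.

(** * A square root commuting with the commutant of B^2 *)

Section SquareRoot.
Context {R : realType} {H : hilbertType R}.
Implicit Types (x y z : H) (r : R) (F G Z : H -> H).

(** Formulated with the real scalar product, this applies to conjugate-linear
    maps too: conjugations are self-adjoint in this sense. *)
Definition adjoint_pair F G := forall x y, rdot (F x) y = rdot x (G y).

Lemma adjoint_pair_sym F G : adjoint_pair F G -> adjoint_pair G F.
Proof. by move=> FG x y; rewrite rdotC -FG rdotC. Qed.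

Lemma adjoint_pairD F G : adjoint_pair F G -> {morph F : x y / x + y}.
Proof.
move=> FG x y; apply: rdot_inj => z.
by rewrite rdotC FG rdotDl -!FG -rdotDl rdotC.
Qed.

Lemma adjoint_pairZ F G : adjoint_pair F G ->
  forall r x, F (rscale r x) = rscale r (F x).
Proof.
move=> FG r x; apply: rdot_inj => z.
by rewrite rdotC FG rdotZl -FG -rdotZl rdotC.
Qed.

Lemma morph_add0 F : {morph F : x y / x + y} -> F 0 = 0.
Proof. by move=> FD; apply: (addIr (F 0)); rewrite -FD !add0r. Qed.

Lemma morph_addN F : {morph F : x y / x + y} -> {morph F : x / - x}.
Proof. by move=> FD x; apply: (addIr (F x)); rewrite -FD !addNr morph_add0. Qed.

Lemma morph_addB F : {morph F : x y / x + y} -> {morph F : x y / x - y}.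
Proof. by move=> FD x y; rewrite FD (morph_addN _ FD). Qed.

Lemma morph_half F : {morph F : x y / x + y} ->
  {morph F : x / rscale 2^-1 x}.
Proof.
move=> FD x; have half y : rscale 2^-1 y + rscale 2^-1 y = y.
  by rewrite -rscaleDl -[RHS]rscale1; congr rscale; field.
by rewrite -{2}[x]half FD rscaleDr half.
Qed.

Lemma real_small_eq0 r (c : R) : (forall n, `|r| <= c / n.+1%:R) -> r = 0.
Proof.
move=> rc; apply/eqP/negPn/negP; rewrite -normr_gt0 => r0.
have c0 : 0 <= c by have := rc 0%N; rewrite divr1; apply: le_trans.
by have [n] := exists_div_lt c _ c0 r0; rewrite ltNge rc.
Qed.

Lemma nrm_small_eq0 v (c : R) : (forall n, nrm v <= c / n.+1%:R) -> v = 0 :> H.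
Proof.
by move=> vc; apply/nrm_eq0/(real_small_eq0 _ c); rewrite ger0_norm ?nrm_ge0.
Qed.

Context (A : H -> H) (A_selfadj : adjoint_pair A A).
Context (A_le1 : forall x, nrm (A x) <= nrm x).

(** If Y is a fixed point of Y |-> (A + Y^2) / 2, then (1 - Y)^2 = 1 - A. The
    iteration from 0 yields polynomials in A, whence all commutation
    properties. *)
Fixpoint sqrt_iter n x : H :=
  if n is m.+1 then rscale 2^-1 (A x + sqrt_iter m (sqrt_iter m x)) else 0.

(** The same iteration for A = 1 in the real numbers. It majorizes the operator
    iteration, because the polynomials have nonnegative coefficients. *)
Fixpoint sqrt_iter_scalar n : R :=
  if n is m.+1 then 2^-1 * (1 + sqrt_iter_scalar m ^+ 2) else 0.

Notation Y := sqrt_iter.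
Notation y_ := sqrt_iter_scalar.

Lemma sqrt_iter_scalar_bounds n : 0 <= y_ n /\ y_ n <= 1.
Proof.
elim: n => [|n [y0 y1]] /=; first by rewrite lexx ler01.
by split; nra.
Qed.

(** With e = 1 - y, the recurrence reads e' = e - e^2 / 2. *)
Lemma sqrt_iter_scalar_rate n : 1 - y_ n <= 2 / n.+2%:R.
Proof.
elim: n => [|n IHn]; first by rewrite /= ler_pdivlMr // subr0 mul1r.
have [y0 y1] := sqrt_iter_scalar_bounds n.
rewrite ler_pdivlMr ?ltr0Sn // mulrC -[n.+3]addn1 natrD mulrC /=.
move: IHn; rewrite ler_pdivlMr ?ltr0Sn //.
have : 2 <= n.+2%:R :> R by rewrite ler_nat.
move: (y_ n) y0 y1 (n.+2%:R) => y y0 y1 k k2 yk.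
have : 0 <= (2 - (1 - y) * k) * (2 - (1 - y)) by apply: mulr_ge0; lra.
have := sqr_ge0 (1 - y).
by nra.
Qed.

Lemma sqrt_iter_scalar_nondecreasing n : y_ n <= y_ n.+1.
Proof. by have := sqr_ge0 (1 - y_ n); rewrite /=; nra. Qed.

Lemma sqrt_iter_selfadj n : adjoint_pair (Y n) (Y n).
Proof.
elim: n => [|n IHn] x y /=; first by rewrite -(rscale0 0) !rdotE !mul0r.
by rewrite !rdotE A_selfadj !IHn.
Qed.

Lemma sqrt_iter_le n x : nrm (Y n x) <= y_ n * nrm x.
Proof.
elim: n x => [|n IHn] x /=; first by rewrite -(rscale0 0) nrmZ normr0 !mul0r.
rewrite nrmZ ger0_norm ?invr_ge0 // -mulrA ler_pM2l ?invr_gt0 //.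
rewrite (le_trans (nrmD _ _)) // mulrDl mul1r lerD //.
have [y0 _] := sqrt_iter_scalar_bounds n.
by rewrite (le_trans (IHn _)) // expr2 -mulrA ler_wpM2l.
Qed.

(** Y'^2 - Y^2 = Y' (Y' - Y) + (Y' - Y) Y, and each term is bounded by its
    counterpart in y'^2 - y^2. *)
Lemma sqrt_iter_step n x :
  nrm (Y n.+1 x - Y n x) <= (y_ n.+1 - y_ n) * nrm x.
Proof.
elim: n x => [|n IHn] x.
  by rewrite !subr0 sqrt_iter_le.
set Y1 := Y n.+1 in IHn *; set y1 := y_ n.+1 in IHn *.
have -> : Y n.+2 x - Y1 x =
    rscale 2^-1 (Y1 (Y1 x - Y n x) + (Y1 (Y n x) - Y n (Y n x))).
  have Y1B : {morph Y1 : x y / x - y}.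
    exact: morph_addB _ (adjoint_pairD _ _ (sqrt_iter_selfadj n.+1)).
  rewrite Y1B addrA subrK.
  rewrite -[LHS]/(rscale 2^-1 (A x + Y1 (Y1 x))
                  - rscale 2^-1 (A x + Y n (Y n x))).
  by rewrite -rscaleBr opprD addrACA subrr add0r.
rewrite nrmZ ger0_norm ?invr_ge0 //.
have [y0 _] := sqrt_iter_scalar_bounds n.
have [y10 _] := sqrt_iter_scalar_bounds n.+1.
rewrite -/y1 in y10.
have le1 : nrm (Y1 (Y1 x - Y n x)) <= y1 * ((y1 - y_ n) * nrm x).
  by rewrite (le_trans (sqrt_iter_le _ _)) // ler_wpM2l.
have le2 : nrm (Y1 (Y n x) - Y n (Y n x)) <= (y1 - y_ n) * (y_ n * nrm x).
  rewrite (le_trans (IHn _)) // ler_wpM2l ?sqrt_iter_le // subr_ge0.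
  exact: sqrt_iter_scalar_nondecreasing.
have := nrmD (Y1 (Y1 x - Y n x)) (Y1 (Y n x) - Y n (Y n x)).
rewrite (_ : y_ n.+2 - y1 = 2^-1 * (y1 ^+ 2 - y_ n ^+ 2)); last first.
  have y1E : y1 = 2^-1 * (1 + y_ n ^+ 2) by [].
  by rewrite [y_ n.+2]/= -/(y_ n.+1) -/y1; clearbody y1; lra.
by move: (nrm (_ + _)) (nrm (Y1 (_ - _))) (nrm (_ - _)) le1 le2 => p q s; nra.
Qed.

Lemma sqrt_iter_cauchy n m x : (n <= m)%N ->
  nrm (Y m x - Y n x) <= (y_ m - y_ n) * nrm x.
Proof.
have refl k : nrm (Y k x - Y k x) <= (y_ k - y_ k) * nrm x.
  by rewrite !subrr mul0r -(rscale0 0) nrmZ normr0 mul0r.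
elim: m => [|m IHm]; first by rewrite leqn0 => /eqP->.
rewrite leq_eqVlt => /predU1P[->|]; first exact: refl.
rewrite ltnS => /IHm {}IHm.
rewrite -[Y m.+1 x](subrK (Y m x)) -addrA (le_trans (nrmD _ _)) //.
by have := sqrt_iter_step m x; rewrite !mulrBl; lra.
Qed.

Lemma sqrt_iter_limit :
  exists L : H -> H, forall n x, nrm (L x - Y n x) <= 2 * nrm x / n.+1%:R.
Proof.
suff /choice[L LP] (x : H) :
    exists l, forall n, nrm (l - Y n x) <= 2 * nrm x / n.+1%:R.
  by exists L.
have rate n : (1 - y_ n) * nrm x <= 2 * nrm x / n.+1%:R.
  rewrite mulrAC ler_wpM2r ?nrm_ge0 // (le_trans (sqrt_iter_scalar_rate n)) //.
  by rewrite ler_pM2l // lef_pV2 ?posrE // ler_nat.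
have [||l lP] := @hilbert_complete R H (fun n => Y n x)
  (fun n => (1 - y_ n) * nrm x).
- move=> n m /(sqrt_iter_cauchy _ _ x)/le_trans; apply.
  rewrite ler_wpM2r ?nrm_ge0 // lerD2r.
  by have [] := sqrt_iter_scalar_bounds m.
- have c0 : 0 <= 2 * nrm x by rewrite mulr_ge0 ?nrm_ge0.
  move=> eps /(exists_div_lt _ _ c0)[n].
  by move=> /(le_lt_trans (rate n)); exists n.
by exists l => n; exact: le_trans (lP n) (rate n).
Qed.

Lemma sqrt_iter_commute Z n : {morph Z : x y / x + y} ->
  (forall x, Z (A x) = A (Z x)) -> forall x, Z (Y n x) = Y n (Z x).
Proof.
move=> ZD ZA; elim: n => [|n IHn] x /=; first exact: morph_add0.
by rewrite (morph_half _ ZD) ZD ZA !IHn.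
Qed.

Section Limit.
Context (L : H -> H).
Context (LP : forall n x, nrm (L x - Y n x) <= 2 * nrm x / n.+1%:R).

(** The properties of the limit hold because the defects vanish for the iterates
    and the distance of L to the iterates is O(1/n). *)
Lemma sqrt_limit_selfadj : adjoint_pair L L.
Proof.
move=> x y; apply/subr0_eq/(real_small_eq0 _ (4 * nrm x * nrm y)) => n.
have -> : rdot (L x) y - rdot x (L y) =
    rdot (L x - Y n x) y - rdot x (L y - Y n y).
  by rewrite !rdotE sqrt_iter_selfadj opprB addrA addrNK.
rewrite (le_trans (ler_normB _ _)) //.
have := cauchy_schwarz_abs (L x - Y n x) y.
have := cauchy_schwarz_abs x (L y - Y n y).
have := ler_wpM2r (nrm_ge0 y) (LP n x).
have := ler_wpM2l (nrm_ge0 x) (LP n y).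
move: (`|_|) (`|_|) => p q.
move: (nrm x) (nrm y) (nrm (_ - _)) (nrm (_ - _)) (n.+1%:R^-1) => a b c d e.
by nra.
Qed.

Lemma sqrt_limit_commute Z k : {morph Z : x y / x + y} ->
  (forall x, nrm (Z x) <= k * nrm x) ->
  (forall x, Z (A x) = A (Z x)) -> forall x, Z (L x) = L (Z x).
Proof.
move=> ZD Zk ZA x.
apply/subr0_eq/(nrm_small_eq0 _ (2 * nrm x * `|k| + 2 * nrm (Z x))) => n.
have -> : Z (L x) - L (Z x) = Z (L x - Y n x) - (L (Z x) - Y n (Z x)).
  rewrite (morph_addB _ ZD) (sqrt_iter_commute _ n ZD ZA).
  by rewrite opprB addrA addrNK.
rewrite (le_trans (nrmD _ _)) // nrmN mulrDl lerD // (le_trans (Zk _)) //.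
rewrite mulrAC [leRHS]mulrC (le_trans (ler_wpM2r (nrm_ge0 _) (ler_norm k))) //.
by rewrite ler_wpM2l.
Qed.

Lemma sqrt_limit_fixed x : L (L x) = L x + L x - A x.
Proof.
have LD := adjoint_pairD _ _ sqrt_limit_selfadj.
apply/subr0_eq/(nrm_small_eq0 _ (6 * nrm x + 2 * nrm (L x))) => n.
have Yn1 : Y n.+1 x + Y n.+1 x = A x + Y n (Y n x).
  by rewrite -rscaleDl -[RHS]rscale1; congr rscale; field.
have -> : L (L x) - (L x + L x - A x) =
    (L (L x) - Y n (L x)) + Y n (L x - Y n x)
      - ((L x - Y n.+1 x) + (L x - Y n.+1 x)).
  rewrite (morph_addB _ (adjoint_pairD _ _ (sqrt_iter_selfadj n))).
  apply: rdot_inj => z; have := congr1 (rdot z) Yn1; rewrite !rdotE; lra.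
rewrite (le_trans (nrmD _ _)) // nrmN.
have le1 : nrm (Y n (L x - Y n x)) <= 2 * nrm x / n.+1%:R.
  apply: le_trans (LP n x); rewrite (le_trans (sqrt_iter_le _ _)) //.
  by have [_ y1] := sqrt_iter_scalar_bounds n; rewrite ler_piMl ?nrm_ge0.
have le2 : nrm (L x - Y n.+1 x) <= 2 * nrm x / n.+1%:R.
  apply: le_trans (LP n.+1 x) _.
  by rewrite ler_wpM2l ?mulr_ge0 ?nrm_ge0 // lef_pV2 ?posrE // ler_nat.
have := LP n (L x).
have := nrmD (L (L x) - Y n (L x)) (Y n (L x - Y n x)).
have := nrmD (L x - Y n.+1 x) (L x - Y n.+1 x).
by move: le1 le2; move: (n.+1%:R^-1) => t; lra.
Qed.

End Limit.
End SquareRoot.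

(** Apply the iteration to A = 1 - B^2, a contraction since
    |A x|^2 = |x|^2 - 2 |B x|^2 + |B^2 x|^2. The point is that Q commutes with
    all Z commuting with B^2, which B need not do. Asking Z to be additive
    rather than linear covers conjugations and multiplication by i. *)
Lemma square_root_of_square {R : realType} {H : hilbertType R} (B : H -> H) :
  adjoint_pair B B -> (forall x, nrm (B x) <= nrm x) ->
  exists Q : H -> H, [/\ adjoint_pair Q Q, forall x, Q (Q x) = B (B x) &
    forall (Z : H -> H) k, {morph Z : x y / x + y} ->
      (forall x, nrm (Z x) <= k * nrm x) ->
      (forall x, Z (B (B x)) = B (B (Z x))) -> forall x, Z (Q x) = Q (Z x)].
Proof.
move=> BB B1; pose A x := x - B (B x).
have AA : adjoint_pair A A by move=> x y; rewrite /A !rdotE !BB.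
have A1 x : nrm (A x) <= nrm x.
  rewrite -(@ler_pXn2r _ 2) ?nnegrE ?nrm_ge0 // -!nrm_sqr.
  have BBx : rdot (B (B x)) x = rdot (B x) (B x) by rewrite BB.
  have : rdot (B (B x)) (B (B x)) <= rdot (B x) (B x).
    by rewrite !nrm_sqr ler_pXn2r ?nnegrE ?nrm_ge0.
  have : 0 <= rdot (B x) (B x) by rewrite nrm_sqr sqr_ge0.
  by rewrite /A !rdotE (rdotC x (B (B x))) BBx; lra.
have [L LP] := sqrt_iter_limit _ AA A1.
have LL := sqrt_limit_selfadj _ AA _ LP; have LD := adjoint_pairD _ _ LL.
exists (fun x => x - L x); split.
- by move=> x y; rewrite !rdotE LL.
- move=> x; rewrite (morph_addB _ LD) (sqrt_limit_fixed _ AA A1 _ LP) /A.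
  by apply: rdot_inj => z; rewrite !rdotE; ring.
- move=> Z k ZD Zk ZB x; rewrite (morph_addB _ ZD).
  rewrite (sqrt_limit_commute _ _ LP _ _ ZD Zk) // => y.
  by rewrite /A (morph_addB _ ZD) ZB.
Qed.

(** * A conjugation commuting with an operator of square zero *)

Section RealStructure.
Context {R : realType} {H : hilbertType R}.
Implicit Types (x y z u v : H) (S : set H).
Context (T Ts : H -> H) (TTs : adjoint_pair T Ts).
Context (TI : forall x, T ('i *: x) = 'i *: T x) (T2 : forall x, T (T x) = 0).

Let TsT : adjoint_pair Ts T. Proof. exact: adjoint_pair_sym. Qed.

Lemma adjoint_pairI x : Ts ('i *: x) = 'i *: Ts x.
Proof.
apply: rdot_inj => z.
by rewrite -TTs -[LHS]opprK -rdotIl -TI TTs rdotIl opprK.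
Qed.

Lemma rdot0 x : rdot x 0 = 0.
Proof. by rewrite -(rscale0 0) rdotZr mul0r. Qed.

Lemma adjoint_square_zero x : Ts (Ts x) = 0.
Proof. by apply: rdot_inj => z; rewrite -!TTs T2 rdotC !rdot0. Qed.

(** The last clause says that the scalar product is real on S, as
    Re <u, i v> = Im <u, v>. *)
Definition real_invariant S :=
  [/\ forall u, S u -> S (T u), forall u, S u -> S (Ts u) &
      forall u v, S u -> S v -> rdot u ('i *: v) = 0].

Lemma maximal_real_invariant :
  exists2 S, real_invariant S &
    forall S', real_invariant S' -> S `<=` S' -> S' `<=` S.
Proof.
have [|S [SP Smax]] := @Zorn_bigcup H real_invariant.
  move=> F FP Ftot; split.
  - by move=> u [S FS Su]; exists S => //; have [ST _ _] := FP S FS; exact: ST.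
  - by move=> u [S FS Su]; exists S => //; have [_ ST _] := FP S FS; exact: ST.
  - move=> u v [S FS Su] [S' FS' Sv].
    have [SS'|S'S] := Ftot S S' FS FS'.
    + by have [_ _ Sr] := FP S' FS'; apply: Sr => //; exact: SS'.
    + by have [_ _ Sr] := FP S FS; apply: Sr => //; exact: S'S.
exists S => // S' S'P SS' x S'x; apply: contrapT => Sx.
by apply: (Smax S') => //; split => // /(_ x S'x).
Qed.

(** Up to the vector 0, the orbit of x under T and T* when T* x = 0 and
    T^2 = 0. *)
Definition alternating_orbit x : set H :=
  [set y | y = 0 \/
    exists n, y = iter n (Ts \o T) x \/ y = T (iter n (Ts \o T) x)].

Let P := Ts \o T.

Lemma P_iter_selfadj n : adjoint_pair (iter n P) (iter n P).
Proof.
elim: n => [//|n IHn] x y.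
by rewrite iterS /P/= TsT TTs -/(P y) IHn -iterSr.
Qed.

Lemma P_iterI n x : iter n P ('i *: x) = 'i *: iter n P x.
Proof. by elim: n => //= n ->; rewrite /P /= TI adjoint_pairI. Qed.

(** A self-adjoint operator has a real quadratic form. *)
Lemma selfadj_real (F : H -> H) x : adjoint_pair F F ->
  (forall y, F ('i *: y) = 'i *: F y) -> rdot (F x) ('i *: x) = 0.
Proof.
move=> FF FI; have := FF x ('i *: x); rewrite FI [RHS]rdotC rdotIl; lra.
Qed.

Lemma alternating_orbit_real x :
  Ts x = 0 -> real_invariant (alternating_orbit x).
Proof.
move=> Tsx; have TsP n : Ts (iter n P x) = 0.
  by case: n => //= n; rewrite /P /= adjoint_square_zero.
have PP n m : rdot (iter n P x) ('i *: iter m P x) = 0.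
  by rewrite -P_iterI -P_iter_selfadj -iterD selfadj_real //;
    [exact: P_iter_selfadj|exact: P_iterI].
have T0 : T 0 = 0 by exact: morph_add0 (adjoint_pairD _ _ TTs).
have Ts0 : Ts 0 = 0 by exact: morph_add0 (adjoint_pairD _ _ TsT).
split.
- move=> u [->|[n [->|->]]]; first by left.
  + by right; exists n; right.
  + by left; rewrite T2.
- move=> u [->|[n [->|->]]]; first by left.
  + by left.
  + by right; exists n.+1; left.
- move=> u v [->|[n [->|->]]]; first by rewrite rdotC rdot0.
  + move=> [->|[m [->|->]]]; first by rewrite scaler0 rdot0.
    * exact: PP.
    * by rewrite -TI -TsT TsP rdotC rdot0.
  + move=> [->|[m [->|->]]]; first by rewrite scaler0 rdot0.
    * by rewrite TTs adjoint_pairI TsP scaler0 rdot0.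
    * by rewrite -TI -TsT -[Ts _]/(iter n.+1 P x) PP.
Qed.

Section Maximal.
Context (S : set H) (SP : real_invariant S).
Context (Smax : forall S', real_invariant S' -> S `<=` S' -> S' `<=` S).

(** The vectors having a real scalar product with all of V. *)
Definition real_dual (V : set H) : set H :=
  [set v | forall s, V s -> rdot v ('i *: s) = 0].

Lemma real_dual_invariant V :
  (forall u, V u -> V (T u)) -> (forall u, V u -> V (Ts u)) ->
  (forall v, real_dual V v -> real_dual V (T v)) /\
  (forall v, real_dual V v -> real_dual V (Ts v)).
Proof.
move=> VT VTs; split=> v Vv s Vs.
- by rewrite TTs adjoint_pairI Vv //; exact: VTs.
- by rewrite TsT TI Vv //; exact: VT.
Qed.

Lemma real_dual_closed V : closed_real_subspace (real_dual V).
Proof. exact: orthogonal_closed. Qed.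

(** The bidual of a set with real scalar products again has real scalar
    products, and it is stable under T and T*. This gives at once that a maximal
    S is closed and stable under real combinations. *)
Lemma maximal_bidual : S = real_dual (real_dual S).
Proof.
have [ST STs Sr] := SP.
have S1 : S `<=` real_dual S by move=> u Su s Ss; exact: Sr.
have S2 : S `<=` real_dual (real_dual S).
  by move=> u Su s Ss; rewrite -[LHS]opprK -rdotIl rdotC Ss // oppr0.
apply/seteqP; split => //; apply: Smax => //.
have [S1T S1Ts] := real_dual_invariant _ ST STs.
have [S2T S2Ts] := real_dual_invariant _ S1T S1Ts.
by split => // u v Su Sv; apply: Su => w Sw; apply: Sv; exact: S1.
Qed.

Lemma maximal_closed : closed_real_subspace S.
Proof. by rewrite maximal_bidual; exact: real_dual_closed. Qed.

(** Otherwise x, or T* x if T* x <> 0, has an orbit that can be added to S. *)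
Lemma maximal_orthogonal x :
  (forall s, S s -> rdot x s = 0 /\ rdot x ('i *: s) = 0) -> x = 0.
Proof.
have [ST STs Sr] := SP.
have orth0 y : Ts y = 0 ->
    (forall s, S s -> rdot y s = 0 /\ rdot y ('i *: s) = 0) -> y = 0.
  move=> Tsy yS; have [OT OTs Or] := alternating_orbit_real y Tsy.
  have Pinv n s : S s -> S (iter n P s).
    by move=> Ss; elim: n => //= n IHn; apply/STs/ST.
  have orb s v : S s -> alternating_orbit y v -> rdot v ('i *: s) = 0.
    move=> Ss [->|[n [->|->]]]; first by rewrite rdotC rdot0.
      by rewrite P_iter_selfadj P_iterI; apply: (yS _ _).2; exact: Pinv.
    rewrite TTs adjoint_pairI P_iter_selfadj P_iterI.
    by apply: (yS _ _).2; apply/Pinv/STs.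
  suff Sy : S y by apply: rdot_eq0; exact: (yS y Sy).1.
  have yO : (S `|` alternating_orbit y) y by right; right; exists 0%N; left.
  apply: Smax yO => [|u Su]; last by left.
  split.
  - by move=> u [/ST|/OT]; [left|right].
  - by move=> u [/STs|/OTs]; [left|right].
  - move=> u v [Su|Ou] [Sv|Ov]; [exact: Sr| |exact: orb|exact: Or].
    by rewrite -[LHS]opprK -rdotIl rdotC orb // oppr0.
move=> xS; apply: (orth0 x) => //.
apply: (orth0 (Ts x)) => [|s Ss]; first exact: adjoint_square_zero.
by rewrite !TsT TI; have [] := xS _ (ST _ Ss).
Qed.

(** If v has real scalar products with S, then so has its component orthogonal
    to S for the real scalar product; that component is orthogonal to S for the
    complex one, hence zero. *)
Lemma maximal_self_dual : real_dual S = S.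
Proof.
apply/seteqP; split=> v Sv; last by have [_ _ Sr] := SP; move=> s; exact: Sr.
have cS := maximal_closed.
have [a Sa va] := orthogonal_projection S v cS.
suff /subr0_eq-> : v - a = 0 by [].
apply: maximal_orthogonal => s Ss; split; first exact: va.
by rewrite rdotDl rdotNl Sv //; have [_ _ ->] := SP; rewrite ?subr0.
Qed.

(** If b is orthogonal to S for the real scalar product, then i b has real
    scalar products with S, hence lies in S. *)
Lemma maximal_span x : exists a b, [/\ S a, S b & x = a + 'i *: b].
Proof.
have cS := maximal_closed.
have [a Sa xa] := orthogonal_projection S x cS.
exists a, (- ('i *: (x - a))); split => //.
  rewrite -maximal_self_dual => s Ss.
  by rewrite rdotNl rdotI xa // oppr0.
by rewrite scalerN scalerA -expr2 sqrCi scaleN1r opprK addrC subrK.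
Qed.

Lemma maximal_conjugation : exists J : H -> H,
  [/\ {morph J : x y / x + y}, forall x, J ('i *: x) = - ('i *: J x),
   involutive J,
   adjoint_pair J J &
   (forall x, J (T x) = T (J x)) /\ forall x, J (Ts x) = Ts (J x)].
Proof.
have [ST STs Sr] := SP.
have cS := maximal_closed.
have [S0 SD SZ _] := cS.
have SN u : S u -> S (- u) by move=> Su; rewrite -rscaleN1; exact: SZ.
have /choice[J JP] (x : H) : exists y, exists a b,
    [/\ S a, S b, x = a + 'i *: b & y = a - 'i *: b].
  by have [a [b [Sa Sb xE]]] := maximal_span x; exists (a - 'i *: b), a, b.
have JE a b : S a -> S b -> J (a + 'i *: b) = a - 'i *: b.
  move=> Sa Sb; have [c [d [Sc Sd E ->]]] := JP (a + 'i *: b).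
  have acP : a - c = 'i *: (d - b).
    rewrite scalerBr; apply: rdot_inj => z.
    by have := congr1 (rdot z) E; rewrite !rdotE; lra.
  have /subr0_eq ac : a - c = 0.
    by apply: rdot_eq0; rewrite {2}acP; apply: Sr; apply: SD => //; exact: SN.
  by rewrite ac in E *; move/addrI: E => ->.
have TD := adjoint_pairD _ _ TTs; have TsD := adjoint_pairD _ _ TsT.
exists J; split.
- move=> x y; have [a [b [Sa Sb -> _]]] := JP x.
  have [c [d [Sc Sd -> _]]] := JP y.
  rewrite addrACA -scalerDr !JE //; try exact: SD.
  by rewrite scalerDr opprD addrACA.
- move=> x; have [a [b [Sa Sb -> _]]] := JP x.
  rewrite scalerDr scalerA -expr2 sqrCi scaleN1r addrC !JE //; last exact: SN.
  by rewrite scalerBr scalerA -expr2 sqrCi scaleN1r opprB.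
- move=> x; have [a [b [Sa Sb -> _]]] := JP x.
  by rewrite JE // -scalerN JE // ?scalerN ?opprK //; exact: SN.
- move=> x y; have [a [b [Sa Sb -> _]]] := JP x.
  have [c [d [Sc Sd -> _]]] := JP y.
  have Sl u v : S u -> S v -> rdot ('i *: u) v = 0.
    by move=> Su Sv; rewrite rdotIl Sr // oppr0.
  by rewrite !JE // !rdotE !rdotI !Sl ?Sr //; ring.
split=> x; have [a [b [Sa Sb -> _]]] := JP x.
- by rewrite JE // TD TI JE ?(morph_addB _ TD) ?TI //; exact: ST.
- rewrite JE // TsD adjoint_pairI JE ?(morph_addB _ TsD) ?adjoint_pairI //;
  exact: STs.
Qed.

End Maximal.
End RealStructure.

(** * Operators of square zero *)

Section SquareZero.
Context {R : realType} {H : hilbertType R}.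
Implicit Types (x y z u v : H) (S : set H).

Lemma reflection_exists (M : set H) : closed_real_subspace M ->
  exists W : H -> H, forall a b,
    M a -> (forall s, M s -> rdot b s = 0) -> W (a + b) = a - b.
Proof.
move=> cM; have [M0 MD MZ _] := cM.
have /choice[p pP] (x : H) :
    exists a, M a /\ forall s, M s -> rdot (x - a) s = 0.
  by have [a Ma xa] := orthogonal_projection M x cM; exists a.
exists (fun x => p x + p x - x) => a b Ma bM.
have [Mp xp] := pP (a + b); set c := p (a + b) in Mp xp *.
have Mac : M (a - c) by rewrite -rscaleN1; apply: MD => //; exact: MZ.
suff /subr0_eq <- : a - c = 0 by rewrite opprD addrA addrK.
apply: rdot_eq0; have := xp _ Mac; have := bM _ Mac.
rewrite (_ : a + b - c = (a - c) + b) ?rdotDl 1?addrAC // => ->.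
by rewrite addr0.
Qed.

Lemma adjoint_pair_le (T Ts : H -> H) k : 0 <= k -> adjoint_pair T Ts ->
  (forall x, nrm (T x) <= k * nrm x) -> forall x, nrm (Ts x) <= k * nrm x.
Proof.
move=> k0 TTs Tk x; have [->|Tx] := eqVneq (nrm (Ts x)) 0.
  by rewrite mulr_ge0 ?nrm_ge0.
have Tx0 : 0 < nrm (Ts x) by rewrite lt_def Tx nrm_ge0.
rewrite -(ler_pM2l Tx0) -expr2 -nrm_sqr -TTs.
apply: le_trans (cauchy_schwarz _ _) _.
by apply: le_trans (ler_wpM2r (nrm_ge0 _) (Tk _)) _; rewrite -mulrA mulrCA.
Qed.

Context (T Ts : H -> H) (TTs : adjoint_pair T Ts).
Context (TI : forall x, T ('i *: x) = 'i *: T x) (T2 : forall x, T (T x) = 0).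
Context (T_le : forall x, nrm (T x) <= 2^-1 * nrm x).

Let TsT : adjoint_pair Ts T. Proof. exact: adjoint_pair_sym. Qed.
Let TsI x : Ts ('i *: x) = 'i *: Ts x. Proof. exact: adjoint_pairI. Qed.
Let Ts2 x : Ts (Ts x) = 0. Proof. exact: adjoint_square_zero T2 _. Qed.
Let TD : {morph T : x y / x + y}. Proof. exact: adjoint_pairD TTs. Qed.
Let TsD : {morph Ts : x y / x + y}. Proof. exact: adjoint_pairD TsT. Qed.

Let Ts_le x : nrm (Ts x) <= 2^-1 * nrm x.
Proof. by apply: (adjoint_pair_le _ _ _ _ TTs) => //; rewrite invr_ge0. Qed.

(** The sign of B = T + T*, taken to be 1 on ker B: the reflection in
    ker (B - Q), where Q^2 = B^2 and Q commutes with T, T* and J. *)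
Lemma intertwining_symmetry : exists W : H -> H,
  [/\ adjoint_pair W W, involutive W, forall x, W ('i *: x) = 'i *: W x,
    forall x, W (T x) = Ts (W x) &
    forall J : H -> H, adjoint_pair J J -> involutive J ->
      (forall x, J (T x) = T (J x)) -> (forall x, J (Ts x) = Ts (J x)) ->
      forall x, J (W x) = W (J x)].
Proof.
pose B x := T x + Ts x.
have BB : adjoint_pair B B by move=> x y; rewrite /B !rdotE TTs TsT addrC.
have B_le x : nrm (B x) <= nrm x.
  by apply: le_trans (nrmD _ _) _; have := T_le x; have := Ts_le x; lra.
have [Q [QQ Q2 Qcomm]] := square_root_of_square B BB B_le.
have QD := adjoint_pairD _ _ QQ; have BD := adjoint_pairD _ _ BB.
have B2 x : B (B x) = T (Ts x) + Ts (T x).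
  by rewrite /B TD TsD T2 Ts2 add0r addr0.
have QT x : T (Q x) = Q (T x).
  apply: (Qcomm T 2^-1) => // y.
  by rewrite !B2 TD T2 T2 (morph_add0 _ TsD) add0r addr0.
have QTs x : Ts (Q x) = Q (Ts x).
  apply: (Qcomm Ts 2^-1) => // y.
  by rewrite !B2 TsD Ts2 Ts2 (morph_add0 _ TD) addr0 add0r.
have QB x : B (Q x) = Q (B x) by rewrite /B QT QTs QD.
have BI x : B ('i *: x) = 'i *: B x by rewrite /B TI TsI scalerDr.
have QI x : 'i *: Q x = Q ('i *: x).
  apply: (Qcomm (fun x => 'i *: x) 1) => [y z|y|y]; first exact: scalerDr.
    by rewrite nrmI mul1r.
  by rewrite !BI.
pose M : set H := [set x | B x = Q x].
have cM : closed_real_subspace M.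
  rewrite (_ : M = [set x | forall z, setT z -> rdot x (B z - Q z) = 0]).
    exact: orthogonal_closed.
  apply/seteqP; split => x /=.
    by move=> BQ z _; rewrite rdotDr rdotNr -BB -QQ BQ subrr.
  move=> h; apply: rdot_inj => z; apply/subr0_eq.
  by rewrite ![rdot z _]rdotC BB QQ -rdotNr -rdotDr h.
have [W WE] := reflection_exists M cM.
pose N : set H := [set b | forall s, M s -> rdot b s = 0].
have cN : closed_real_subspace N by exact: orthogonal_closed.
have [N0 _ NZ _] := cN.
have NN u : N u -> N (- u) by rewrite -rscaleN1; exact: NZ.
have decomp x : exists a b, [/\ M a, N b & x = a + b].
  have [a Ma xa] := orthogonal_projection M x cM.
  by exists a, (x - a); split => //; rewrite addrC subrK.
have MI u : M u -> M ('i *: u) by rewrite /M/= BI -QI => ->.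
have NI u : N u -> N ('i *: u).
  by move=> Nu s Ms; rewrite rdotIl Nu ?oppr0 //; exact: MI.
have WW : adjoint_pair W W.
  move=> x y; have [a [b [Ma Nb ->]]] := decomp x.
  have [c [d [Mc Nd ->]]] := decomp y.
  by rewrite !WE // !rdotE (Nb c) // (rdotC a d) (Nd a) //; ring.
have WK : involutive W.
  move=> x; have [a [b [Ma Nb ->]]] := decomp x.
  by rewrite !WE // ?opprK //; exact: NN.
have WI x : W ('i *: x) = 'i *: W x.
  have [a [b [Ma Nb ->]]] := decomp x.
  by rewrite scalerDr !WE ?scalerBr //; [exact: MI|exact: NI].
have NBQ b : N b -> B b = - Q b.
  move=> Nb; apply: rdot_inj => z; apply/subr0_eq.
  rewrite rdotNr opprK ![rdot z _]rdotC BB QQ -rdotDr; apply: Nb.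
  by rewrite /M /= BD QD -QB Q2 addrC.
have QW x : Q (W x) = B x.
  have [a [b [Ma Nb ->]]] := decomp x.
  by rewrite WE // BD (NBQ b) // (morph_addB _ QD) -Ma.
have WQ x : W (Q x) = B x.
  by apply: rdot_inj => z; rewrite -WW -QQ QW BB.
exists W; split => //.
(* The defect D vanishes on the range of Q and is skew-adjoint, so its range
   lies in ker Q = ker B = ker T /\ ker T*, where W is the identity; this makes
   <D x, D x> vanish. *)
- pose D x := W (T x) - Ts (W x).
  have DQ x : D (Q x) = 0.
    by rewrite /D QT !WQ /B TsD T2 Ts2 add0r addr0 subrr.
  have Dadj x y : rdot (D x) y = - rdot x (D y).
    by rewrite /D !rdotE WW TTs TsT WW; ring.
  have QDx x : Q (D x) = 0.
    by apply: rdot_inj => z; rewrite -QQ rdotC Dadj DQ !rdot0 oppr0.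
  have BDx x : B (D x) = 0.
    by apply: rdot_eq0; rewrite BB -Q2 QDx (morph_add0 _ QD) rdot0.
  have TDx x : T (D x) = 0.
    apply: rdot_eq0; rewrite -[RHS](rdot0 (T (D x))) -(BDx x) /B rdotDr.
    by rewrite [X in _ = _ + X]TTs Ts2 rdot0 addr0.
  have TsDx x : Ts (D x) = 0 by have := BDx x; rewrite /B TDx add0r.
  have WDx x : W (D x) = D x.
    by rewrite -{1}[D x]addr0 WE ?subr0 // /M /= BDx QDx.
  move=> x; apply/subr0_eq/rdot_eq0; rewrite -/(D x).
  by rewrite {1}/D rdotDl rdotNl WW WDx TTs TsDx TsT TDx !rdot0 subr0.
- move=> J JJ JK JT JTs x.
  have JD := adjoint_pairD _ _ JJ.
  have JB y : J (B y) = B (J y) by rewrite /B JD JT JTs.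
  have JQ y : J (Q y) = Q (J y).
    apply: (Qcomm J 1) => // z; last by rewrite !JB.
    by rewrite mul1r -(@ler_pXn2r _ 2) ?nnegrE ?nrm_ge0 // -!nrm_sqr JJ JK.
  have JM u : M u -> M (J u) by rewrite /M /= -JB -JQ => ->.
  have JN u : N u -> N (J u) by move=> Nu s Ms; rewrite JJ Nu //; exact: JM.
  have [a [b [Ma Nb ->]]] := decomp x.
  by rewrite JD !WE ?(morph_addB _ JD) //; [exact: JM|exact: JN].
Qed.

(** Take C = W J. Then C T* C = W T* W = T. *)
Lemma square_zero_conjugation : exists C : H -> H,
  [/\ {morph C : x y / x + y}, forall r x, C (rscale r x) = rscale r (C x),
    forall x, C ('i *: x) = - ('i *: C x),
    involutive C /\ forall x, nrm (C x) = nrm x &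
    forall x, C (Ts (C x)) = T x].
Proof.
have [S SP Smax] := maximal_real_invariant T Ts.
have [J [JD JI JK JJ [JT JTs]]] := maximal_conjugation _ _ TTs TI T2 S SP Smax.
have [W [WW WK WI WT WJ]] := intertwining_symmetry.
have JW := WJ J JJ JK JT JTs.
have CC : adjoint_pair (W \o J) (J \o W) by move=> x y /=; rewrite WW JJ.
exists (W \o J); split.
- exact: adjoint_pairD CC.
- exact: adjoint_pairZ CC.
- by move=> x /=; rewrite JI (morph_addN _ (adjoint_pairD _ _ WW)) WI.
- split=> x /=; first by rewrite JW JK WK.
  apply/eqP; rewrite -(@eqrXn2 _ 2) ?nrm_ge0 // -!nrm_sqr WW WK JJ JK //.
- by move=> x /=; rewrite JTs JW JK -WT WK.
Qed.

End SquareZero.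

(** * Reduction to operators of square zero *)

(** Re <F u, u> is affine along x + t F x, with slope |F x|^2. *)
Lemma accretive_square_zero {R : realType} {H : hilbertType R} (F : H -> H) :
  {morph F : x y / x + y} -> (forall r x, F (rscale r x) = rscale r (F x)) ->
  (forall x, F (F x) = 0) -> (forall x, 0 <= rdot (F x) x) ->
  forall x, F x = 0.
Proof.
move=> FD FZ F2 F0 x; apply: rdot_eq0; apply/eqP/negPn/negP => Fx.
have Fx0 : 0 < rdot (F x) (F x) by rewrite lt_def Fx nrm_sqr sqr_ge0.
have := F0 (x + rscale (- ((rdot (F x) x + 1) / rdot (F x) (F x))) (F x)).
rewrite FD FZ F2 -(rscale0 0) rscaleA !rdotE mulr0 !mul0r addr0 mulNr divfK //.
by lra.
Qed.

Section Reduction.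
Context {R : realType} {H : hilbertType R}.

Lemma conj_linear_rscale (C : H -> H) : {morph C : x y / x + y} ->
  (forall r x, C (rscale r x) = rscale r (C x)) ->
  (forall x, C ('i *: x) = - ('i *: C x)) ->
  linear_for (@Num.conj R[i] \; *:%R) C.
Proof.
move=> CD CZ CI a x y; rewrite CD; congr (_ + _).
rewrite [a *: x]scale_rscale CD !CZ CI.
rewrite /= conjE [RHS]scale_rscale; case: a => p q /=.
by rewrite -rscaleN1 !rscaleA mulrN1.
Qed.

Lemma adjointE (S Ss : H -> H) : adjoint_pair S Ss ->
  (forall x, S ('i *: x) = 'i *: S x) -> adjoint S = Ss.
Proof.
move=> SSs SI; apply/funext => y; apply: xget_unique => [x|z zP].
  by rewrite !hdotE SSs -(adjoint_pairI _ _ SSs SI) SSs.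
by apply: rdot_inj => x; rewrite -SSs /rdot zP.
Qed.

Lemma conjugation_complex_symmetric (T Ts : H -> H) (C : H -> H) :
  adjoint_pair T Ts -> (forall x, T ('i *: x) = 'i *: T x) ->
  {morph C : x y / x + y} ->
  (forall r x, C (rscale r x) = rscale r (C x)) ->
  (forall x, C ('i *: x) = - ('i *: C x)) ->
  involutive C -> (forall x, nrm (C x) = nrm x) ->
  (forall x, C (Ts (C x)) = T x) -> complex_symmetric T.
Proof.
move=> TTs TI CD CZ CI CK Cnrm CTC; exists C.
  by split=> [||x]; [exact: conj_linear_rscale| |rewrite !nrm_norm Cnrm].
by apply/funext => x /=; rewrite (adjointE _ _ TTs TI) CTC.
Qed.

(** Both hypothesis and conclusion are invariant under scaling by a positive
    number, so T may be assumed to have norm at most 1/2, which makes T + T* a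
    contraction. *)
Lemma square_zero_complex_symmetric (T : {linear H -> H}) (M : R) :
  (forall x, nrm (T x) <= M * nrm x) -> (forall x, T (T x) = 0) ->
  complex_symmetric T.
Proof.
move=> TM T2; have [Ts TTs] := adjoint_exists T M TM.
have TI x : T ('i *: x) = 'i *: T x by rewrite linearZ.
pose c := 2 * (`|M| + 1); have c0 : 0 < c by rewrite mulr_gt0 // ltr_wpDl.
have TZ := adjoint_pairZ _ _ TTs.
pose T' x := rscale c^-1 (T x); pose Ts' x := rscale c^-1 (Ts x).
have T'Ts' : adjoint_pair T' Ts' by move=> x y; rewrite !rdotE TTs.
have [|||C [CD CZ CI [CK Cnrm] CTC]] :=
  @square_zero_conjugation R H T' Ts' T'Ts'.
- by move=> x; rewrite /T' TI rscaleI.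
- by move=> x; rewrite /T' TZ T2 -(rscale0 0) !rscaleA !mulr0.
- move=> x; rewrite /T' nrmZ gtr0_norm ?invr_gt0 // ler_pdivrMl //.
  have -> : c * (2^-1 * nrm x) = (`|M| + 1) * nrm x by rewrite /c; field.
  rewrite (le_trans (TM x)) // ler_wpM2r ?nrm_ge0 //.
  by rewrite (le_trans (ler_norm M)) // lerDl.
apply: (conjugation_complex_symmetric T Ts C) => // x.
have := congr1 (rscale c) (CTC x).
by rewrite /T' /Ts' CZ !rscaleA mulfV ?gt_eqF // !rscale1.
Qed.

Lemma inv2_rscale (x : H) : 2^-1 *: x = rscale 2^-1 x.
Proof. by rewrite /rscale fmorphV rmorph_nat. Qed.

Lemma inv2i_rscale (x : H) : (2 * 'i)^-1 *: x = - rscale 2^-1 ('i *: x).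
Proof.
by rewrite invfM invCi mulrN scaleNr -scalerA inv2_rscale.
Qed.

Lemma positive_op_rdot (S : H -> H) :
  positive_op S -> forall x, 0 <= rdot (S x) x.
Proof. by move=> S0 x; have := S0 x; rewrite lecE => /andP[]. Qed.

(** Im S is the real part of -i S, which has square zero as well. *)
Lemma re_im_positive_eq0 (S Ss : H -> H) : adjoint_pair S Ss ->
  (forall x, S ('i *: x) = 'i *: S x) -> (forall x, S (S x) = 0) ->
  positive_op (re_op S) \/ positive_op (im_op S) -> forall x, S x = 0.
Proof.
move=> SSs SI S2; have SD := adjoint_pairD _ _ SSs.
have SZ := adjoint_pairZ _ _ SSs.
case=> /positive_op_rdot S0 x.
  apply: accretive_square_zero => // y; have := S0 y.
  rewrite /re_op (adjointE _ _ SSs SI) inv2_rscale !rdotE.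
  by rewrite [rdot (Ss y) y]rdotC -SSs; lra.
suff : - ('i *: S x) = 0.
  move/eqP; rewrite oppr_eq0 scaler_eq0 => /orP[|/eqP//].
  by rewrite (negbTE (neq0Ci _)).
move: x; apply: accretive_square_zero => [x y|r x|x|x].
- by rewrite SD scalerDr opprD.
- by rewrite SZ rscaleI -!rscaleN1 !rscaleA mulrC.
- by rewrite (morph_addN _ SD) SI S2 !scaler0 !oppr0 scaler0 oppr0.
- have := S0 x.
  rewrite /im_op (adjointE _ _ SSs SI) inv2i_rscale scalerBr !rdotE !rdotIl.
  by rewrite [rdot (Ss x) _]rdotC -SSs SI rdotIl; lra.
Qed.

End Reduction.

Theorem corollary4p3 (R : realType) (H : hilbertType R) (T : {linear H -> H})
  (dimH : dim_geq H 3)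
  (T_bounded : exists M : R[i], forall x : H, `|T x| <= M * `|x|)
  (T3 : forall x : H, iter 3 T x = 0)
  (T2_pos : positive_op (re_op (iter 2 T)) \/ positive_op (im_op (iter 2 T))) :
  complex_symmetric T.
Proof.
have [M TM] : exists M : R, forall x, nrm (T x) <= M * nrm x.
  have [M TM] := T_bounded; exists (complex.Re M) => x.
  have := TM x; rewrite !nrm_norm [M * _]mulrC lecE => /andP[_].
  by case: (M) => p q /=; rewrite mul0r subr0 mulrC.
apply: (square_zero_complex_symmetric T M TM) => x.
have [Ts TTs] := adjoint_exists T M TM.
apply: (re_im_positive_eq0 (iter 2 T) (Ts \o Ts) _ _ _ T2_pos x)
  => [y z|y|y] /=.
- by rewrite !TTs.
- by rewrite !linearZ.
- by rewrite -[RHS](linear0 T) -[in RHS](T3 y).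
Qed.
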